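(* Let $R$ be a unital ring and let $M$ be a right $R$-module that is both a $UC$-module and an extending module. Then $M$ is a $Rad$-$D_{11}$-module if and only if $M$ is a $C$-$Rad$-$D_{11}$-module.
   Context: All rings are unital and all modules are right modules. $Rad(L)$ denotes the Jacobson radical of a module $L$ (the sum of all its small submodules). A submodule of $M$ is closed if it has no proper essential extension inside $M$; a closure of a submodule $N$ in $M$ is a closed submodule $K$ of $M$ such that $N$ is essential in $K$. $M$ is a $UC$-module if every submodule of $M$ has a unique closure in $M$. $M$ is extending if every closed submodule of $M$ is a direct summand of $M$. For submodules $N,L$ of $M$, $L$ is a $Rad$-supplement of $N$ in $M$ if $N+L=M$ and $N\cap L\subseteq Rad(L)$. A module $M$ is a $Rad$-$D_{11}$-module if every submodule of $M$ has a $Rad$-supplement in $M$ that is a direct summand of $M$. A module $M$ is a $C$-$Rad$-$D_{11}$-module if every direct summand of $M$ is a $Rad$-$D_{11}$-module. *)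

(* Defs.v *)
From mathcomp Require Import all_boot all_order all_algebra.
From mathcomp Require Import mathcomp_extra boolp classical_sets.

Set Implicit Arguments.
Unset Strict Implicit.
Unset Printing Implicit Defensive.

Import GRing.Theory.

Local Open Scope classical_set_scope.
Local Open Scope ring_scope.

(* A right module over R is an lmodType over the converse ring R^c: the action
   x a of a on x is written a *: x.

   Submodules are Prop-valued sets in an ambient module M, and every notion
   below is relative to a submodule L of M, regarded as a module in its own
   right: the submodules of the module L are the submodules of M contained in
   L.  The module M itself is [set: M]. *)
Section Submodules.
Variables (R : pzRingType) (M : lmodType R^c).
Implicit Types (K L N S : set M).

Definition submodule N L : Prop := GRing.submod_closed [in N] /\ N `<=` L.

Definition sumset N K : set M := [set x + y | x in N & y in K].

Definition direct_summand K L : Prop :=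
  submodule K L /\
  exists K', [/\ submodule K' L, sumset K K' = L & K `&` K' = [set 0]].

Definition essential N K : Prop :=
  submodule N K /\
  forall S, submodule S K -> N `&` S = [set 0] -> S = [set 0].

Definition closed_submodule K L : Prop :=
  submodule K L /\
  forall K', submodule K' L -> essential K K' -> K' = K.

Definition closure_in K N L : Prop := closed_submodule K L /\ essential N K.

Definition UC_module L : Prop :=
  forall N, submodule N L -> exists! K, closure_in K N L.

Definition extending_module L : Prop :=
  forall K, closed_submodule K L -> direct_summand K L.

Definition small_submodule S L : Prop :=
  submodule S L /\
  forall K, submodule K L -> sumset S K = L -> K = L.

(* The sum of a family of submodules consists of the finite sums of elements
   of its members. *)
Definition Rad L : set M :=
  [set m | exists (n : nat) (x : 'I_n -> M),
     (forall i, exists2 S, small_submodule S L & S (x i)) /\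
     m = \sum_(i < n) x i].

Definition Rad_supplement K N L : Prop :=
  [/\ submodule K L, sumset N K = L & N `&` K `<=` Rad K].

Definition Rad_D11_module L : Prop :=
  forall N, submodule N L ->
  exists2 K, Rad_supplement K N L & direct_summand K L.

Definition C_Rad_D11_module L : Prop :=
  forall D, direct_summand D L -> Rad_D11_module D.

End Submodules.

(* Main.v *)
Require Import Defs.
From mathcomp Require Import all_boot all_order all_algebra.
From mathcomp Require Import mathcomp_extra boolp classical_sets.

(** The property passes from [M] to a direct summand [D] because, under the two
    hypotheses on [M], the intersection of two direct summands of [M] is again
    a direct summand.

    Granting this, take a submodule [N] of [D] and a Rad-supplement [K] of [N]
    in [M] that is a direct summand of [M].  Then [D `&` K] is what is wanted:
    the modular law turns [N + K = M] into [N + (D `&` K) = D]; the summand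
    [D `&` K] of [M] is a fortiori a summand of [D] and of [K]
    ([direct_summandS]); and the radical of [K] meets a summand of [K] inside
    the radical of that summand ([Rad_direct_summand]), because the projection
    of a small submodule is small.

    The intersection property ([direct_summandI]) comes from uniqueness of
    closures.  If [C] is the closure of a submodule [N] of a summand [A], with
    complement [B], then [C] meets [B] trivially, so the projection onto [A]
    along [B] is injective on [C] and fixes [N]; hence [N] is essential in the
    image [P] of [C].  A closure of [P] is also a closure of [N], so it is [C],
    and [P] lies in [C].  Subtracting from an element of [C] its projection
    gives an element of [C `&` B = 0], so [C] is contained in [A]
    ([closure_sub_direct_summand]).  The closure of the intersection of two
    summands is therefore contained in both, which makes the intersection
    closed, hence a summand since [M] is extending.

    The projection onto [A] along [B] never appears as a map: the image of [S]
    is the submodule [A `&` (S + B)], and every argument takes place in the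
    lattice of submodules. *)

Set Implicit Arguments.
Unset Strict Implicit.
Unset Printing Implicit Defensive.

Import GRing.Theory.

Local Open Scope classical_set_scope.
Local Open Scope ring_scope.

Section SubmoduleLattice.
Variables (R : pzRingType) (M : lmodType R^c).
Implicit Types (A B C D K L N P S X : set M).

(** * The lattice of submodules *)

Lemma submodule_intro N L :
  [/\ N 0, (forall x y, N x -> N y -> N (x + y)),
      (forall a x, N x -> N (a *: x)) & N `<=` L] -> submodule N L.
Proof.
move=> [N0 ND NZ NL]; split=> //; split=> [|a u v /set_mem Nu /set_mem Nv].
  exact: mem_set.
by apply: mem_set; apply: ND => //; apply: NZ.
Qed.

Lemma submodule0 N L : submodule N L -> N 0.
Proof. by move=> [[/set_mem]]. Qed.

Lemma submoduleD N L x y : submodule N L -> N x -> N y -> N (x + y).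
Proof.
move=> [[_ lN] _] Nx Ny; rewrite -[x]scale1r.
by apply/set_mem/lN; apply: mem_set.
Qed.

Lemma submoduleZ N L a x : submodule N L -> N x -> N (a *: x).
Proof.
move=> sN; have [[_ lN] _] := sN => Nx; rewrite -[a *: x]addr0.
by apply/set_mem/lN; apply: mem_set => //; apply: submodule0 sN.
Qed.

Lemma submoduleN N L x : submodule N L -> N x -> N (- x).
Proof. by move=> sN Nx; rewrite -scaleN1r; apply: submoduleZ sN _. Qed.

Lemma submoduleB N L x y : submodule N L -> N x -> N y -> N (x - y).
Proof. by move=> sN Nx Ny; apply: (submoduleD sN) => //; apply: submoduleN sN _. Qed.

Lemma submodule_sum N L n (x : 'I_n -> M) :
  submodule N L -> (forall i, N (x i)) -> N (\sum_(i < n) x i).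
Proof.
move=> sN Nx; apply: (big_ind N) => [|y z|i _].
- exact: submodule0 sN.
- exact: submoduleD sN.
- exact: Nx.
Qed.

Lemma submoduleW N L X : submodule N L -> N `<=` X -> submodule N X.
Proof. by move=> [lN _] NX; split. Qed.

Lemma submodule_trans N K L : submodule N K -> submodule K L -> submodule N L.
Proof. by move=> sN [_ KL]; apply: (submoduleW sN); apply: subset_trans KL; case: sN. Qed.

Lemma submoduleI N K L : submodule N L -> submodule K L -> submodule (N `&` K) L.
Proof.
move=> sN sK; apply: submodule_intro; split.
- by split; [apply: submodule0 sN | apply: submodule0 sK].
- by move=> x y [Nx Kx] [Ny Ky]; split; [apply: submoduleD sN _ _ | apply: submoduleD sK _ _].
- by move=> a x [Nx Kx]; split; [apply: submoduleZ sN _ | apply: submoduleZ sK _].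
- by case: sN => _ NL x [/NL].
Qed.

Lemma submodule_sumset N K L :
  submodule L L -> submodule N L -> submodule K L -> submodule (sumset N K) L.
Proof.
move=> sL sN sK; apply: submodule_intro; split.
- exists 0; first exact: submodule0 sN.
  by exists 0; [apply: submodule0 sK | rewrite addr0].
- move=> _ _ [x Nx [y Ky <-]] [x' Nx' [y' Ky' <-]].
  exists (x + x'); first exact: submoduleD sN _ _.
  by exists (y + y'); [apply: submoduleD sK _ _ | rewrite addrACA].
- move=> a _ [x Nx [y Ky <-]]; exists (a *: x); first exact: submoduleZ sN _.
  by exists (a *: y); [apply: submoduleZ sK _ | rewrite scalerDr].
- move=> _ [x Nx [y Ky <-]]; apply: submoduleD sL _ _.
    by case: sN => _; apply.
  by case: sK => _; apply.
Qed.

Lemma sumset_modular N D K L :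
  submodule N L -> submodule D L -> N `<=` D ->
  sumset N (D `&` K) = D `&` sumset N K.
Proof.
move=> sN sD ND; apply/seteqP; split=> z.
  move=> [x Nx [y [Dy Ky] <-]]; split; first exact: submoduleD sD (ND _ Nx) Dy.
  by exists x => //; exists y.
move=> [Dz [x Nx [y Ky xyz]]]; exists x => //; exists y => //; split=> //.
have -> : y = z - x by rewrite -xyz addrC addKr.
exact: submoduleB sD Dz (ND _ Nx).
Qed.

Lemma set0_submodule_eq N L : submodule N L -> N `<=` [set 0] -> N = [set 0].
Proof.
by move=> sN N0; apply/seteqP; split=> // _ ->; apply: submodule0 sN.
Qed.

Lemma essential_trans N K P :
  submodule K P -> essential N K -> essential K P -> essential N P.
Proof.
move=> sK [sN eN] [_ eK]; split; first exact: submodule_trans sN sK.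
move=> S sS NS0; apply: eK => //; apply: eN.
  by apply: (submoduleW (submoduleI sK sS)) => x [].
by apply/seteqP; split=> x; [case=> Nx [_ Sx]; rewrite -NS0
  | rewrite -NS0 => -[Nx Sx]; split=> //; split=> //; case: sN => _; apply].
Qed.

(** * Direct summands *)

Lemma direct_summandS K D L :
  submodule D L -> direct_summand K L -> K `<=` D -> direct_summand K D.
Proof.
move=> sD [sK [X [sX KX KX0]]] KD; split; first exact: submoduleW sK KD.
exists (D `&` X); split.
- by apply: (submoduleW (submoduleI sD sX)) => x [].
- rewrite (sumset_modular X sK sD KD) KX.
  by apply/seteqP; split=> [x []//|x Dx]; split=> //; case: sD => _; apply.
- by rewrite setIA ((setIidPl _ _).2 KD).
Qed.

(** The projection onto [A] along [B] of a small submodule of [A + B] is small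
    in [A]: if [X] and the projection of [S] generate [A], then [S] and [X + B]
    generate [A + B], so that [X + B] is everything and [X = A]. *)
Lemma small_projection A B L S :
  submodule L L -> submodule A L -> submodule B L ->
  sumset A B = L -> A `&` B = [set 0] ->
  small_submodule S L -> small_submodule (A `&` sumset S B) A.
Proof.
move=> sL sA sB AB AB0 [sS smallS].
have sSB := submodule_sumset sL sS sB.
split; first by apply: (submoduleW (submoduleI sA sSB)) => x [].
move=> X sX PX.
have sXL := submodule_trans sX sA.
have sXB := submodule_sumset sL sXL sB.
have XA : X `<=` A by case: sX.
have XBL : sumset X B = L.
  apply: smallS => //; apply/seteqP; split.
    by case: (submodule_sumset sL sS sXB).
  rewrite -{1}AB -{1}PX => _ [_ [p [_ [s Ss [b Bb <-]]] [x Xx <-]] [b' Bb' <-]].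
  exists s => //; exists (x + (b + b')).
    by exists x => //; exists (b + b') => //; apply: submoduleD sB _ _.
  by rewrite -!addrA; congr (_ + _); rewrite addrCA.
have := sumset_modular B sXL sA XA.
rewrite AB0 XBL ((setIidPl _ _).2 (proj2 sA)) => <-.
apply/seteqP; split=> [x Xx|_ [x Xx [_ -> <-]]]; last by rewrite addr0.
by exists x => //; exists 0; rewrite ?addr0.
Qed.

(** An element of [A] that is a sum of elements of small submodules of [K] is
    its own projection, hence the sum of the projections of these elements. *)
Lemma Rad_direct_summand A K :
  submodule K K -> direct_summand A K -> A `&` Rad K `<=` Rad A.
Proof.
move=> sK [sA [B [sB AB AB0]]] m [Am [n [x [Sx mE]]]].
have /choice [a aP] : forall i, exists a,
    B (x i - a) /\ (exists2 S, small_submodule S A & S a).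
  move=> i; have [S smS Sxi] := Sx i.
  have : K (x i) by case: smS => -[_ SK] _; apply: SK.
  rewrite -{1}AB => -[a Aa [b Bb abx]]; exists a.
  split; first by rewrite -abx addrC addKr.
  exists (A `&` sumset S B); first exact: (small_projection sK).
  split=> //; exists (x i) => //; exists (- b); first exact: submoduleN sB Bb.
  by rewrite -abx addrK.
exists n, a; split=> [i|]; first by have [] := aP i.
have Aa i : A (a i) by have [_ [S [[_ SA] _] Sa]] := aP i; apply: SA.
apply/eqP; rewrite -subr_eq0; apply/eqP.
suff : (A `&` B) (m - \sum_(i < n) a i) by rewrite AB0.
split; first exact: submoduleB sA Am (submodule_sum sA Aa).
by rewrite mE -sumrB; apply: (submodule_sum sB) => i; have [] := aP i.
Qed.

(** * Closures in UC-modules *)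

(** [C] and its projection [A `&` (C + B)] are isomorphic over [N]: a
    submodule [S] of the projection that avoids [N] lifts to the submodule
    [C `&` (S + B)] of [C] that avoids [N]. *)
Lemma essential_projection N A B C L :
  submodule L L -> submodule A L -> submodule B L -> submodule C L ->
  A `&` B = [set 0] -> N `<=` A ->
  essential N C -> essential N (A `&` sumset C B).
Proof.
move=> sL sA sB sC AB0 NA [sN eN]; split.
  apply: (submoduleW sN) => x Nx; split; first exact: NA.
  exists x; first by case: sN => _; apply.
  by exists 0; [apply: submodule0 sB | rewrite addr0].
move=> S sS NS0.
have sSL : submodule S L.
  by apply: (submodule_trans sS); apply: submoduleI => //; apply: submodule_sumset.
have SA : S `<=` A by case: sS => _ SP x /SP [].
have sSB := submodule_sumset sL sSL sB.
have T0 : C `&` sumset S B = [set 0].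
  apply: eN; first by apply: (submoduleW (submoduleI sC sSB)) => x [].
  have sNL := submodule_trans sN sC.
  apply: (set0_submodule_eq (submoduleI sNL (submoduleI sC sSB))).
  move=> z [Nz [_ [s Ss [b Bb sbz]]]].
  have b0 : b = 0.
    suff : (A `&` B) b by rewrite AB0.
    split=> //; have -> : b = z - s by rewrite -sbz addrC addKr.
    exact: submoduleB sA (NA _ Nz) (SA _ Ss).
  rewrite -NS0; split=> //.
  by rewrite -sbz b0 addr0.
apply: (set0_submodule_eq sSL) => s Ss.
have [_ [c Cc [b Bb cbs]]] : (A `&` sumset C B) s by case: sS => _; apply.
have c0 : c = 0.
  suff : (C `&` sumset S B) c by rewrite T0.
  split=> //; exists s => //; exists (- b); first exact: submoduleN sB Bb.
  by rewrite -cbs addrK.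
suff : (A `&` B) s by rewrite AB0.
by split; [apply: SA | rewrite -cbs c0 add0r].
Qed.

(** The projection of [C] lies in [C] because its closure is a closure of [N],
    and there is only one. *)
Lemma closure_sub_direct_summand N A C L :
  submodule L L -> UC_module L -> direct_summand A L -> N `<=` A ->
  closure_in C N L -> C `<=` A.
Proof.
move=> sL UC [sA [B [sB AB AB0]]] NA [clC eNC].
have sC : submodule C L by case: clC.
have sNL : submodule N L by apply: submodule_trans sC; case: eNC.
pose P := A `&` sumset C B.
have sP : submodule P L := submoduleI sA (submodule_sumset sL sC sB).
have eNP : essential N P := essential_projection sL sA sB sC AB0 NA eNC.
have [C' [[clC' ePC'] _]] := UC P sP.
have PC' : P `<=` C' by case: ePC' => -[].
have [C0 [_ C0uniq]] := UC N sNL.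
have C'C : C' = C.
  rewrite -(C0uniq C) //; apply/esym/C0uniq; split=> //.
  by apply: (essential_trans _ eNP ePC'); case: ePC'.
have CB0 : C `&` B = [set 0].
  case: eNC => sN; apply.
    by apply: (submoduleW (submoduleI sC sB)) => x [].
  apply: (set0_submodule_eq (submoduleI sNL (submoduleI sC sB))).
  by move=> x [Nx [_ Bx]]; rewrite -AB0; split=> //; apply: NA.
move=> c Cc; have : L c by case: sC => _; apply.
rewrite -AB => -[a Aa [b Bb abc]].
have Ca : C a.
  rewrite -C'C; apply: PC'; split=> //; exists c => //.
  by exists (- b); [apply: submoduleN sB Bb | rewrite -abc addrK].
suff b0 : b = 0 by rewrite -abc b0 addr0.
suff : (C `&` B) b by rewrite CB0.
split=> //; have -> : b = c - a by rewrite -abc addrC addKr.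
exact: submoduleB sC Cc Ca.
Qed.

Lemma direct_summandI D K L :
  submodule L L -> UC_module L -> extending_module L ->
  direct_summand D L -> direct_summand K L -> direct_summand (D `&` K) L.
Proof.
move=> sL UC ext dD dK; apply: ext.
have [C [clC _]] := UC _ (submoduleI (proj1 dD) (proj1 dK)).
suff -> : D `&` K = C by case: clC.
apply/seteqP; split; first by case: clC => _ [[]].
move=> x Cx; split.
  by apply: (closure_sub_direct_summand sL UC dD _ clC) => // y [].
by apply: (closure_sub_direct_summand sL UC dK _ clC) => // y [].
Qed.

(** * Rad-supplements in direct summands *)

Lemma Rad_D11_direct_summand D L :
  submodule L L -> UC_module L -> extending_module L ->
  Rad_D11_module L -> direct_summand D L -> Rad_D11_module D.
Proof.
move=> sL UC ext D11 dD N sN.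
have sD := proj1 dD; have ND := proj2 sN.
have sNL := submodule_trans sN sD.
have [K [sK NK NKRad] dK] := D11 N sNL.
have dDK := direct_summandI sL UC ext dD dK.
exists (D `&` K); last by apply: direct_summandS sD dDK _ => x [].
split.
- by apply: (submoduleW (proj1 dDK)) => x [].
- by rewrite (sumset_modular K sNL sD ND) NK; apply/setIidPl; case: sD.
- move=> x [Nx [Dx Kx]]; apply: (@Rad_direct_summand _ K).
  + exact: submoduleW sK _.
  + by apply: direct_summandS sK dDK _ => y [].
  + by split=> //; apply: NKRad.
Qed.

Lemma direct_summand_refl L : submodule L L -> direct_summand L L.
Proof.
move=> sL; split=> //; exists [set 0]; split.
- apply: submodule_intro; split=> //.
  + by move=> _ _ -> ->; rewrite addr0.
  + by move=> a _ ->; rewrite scaler0.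
  + by move=> _ ->; apply: submodule0 sL.
- apply/seteqP; split=> [_ [x Lx [_ -> <-]]|x Lx]; first by rewrite addr0.
  by exists x => //; exists 0; rewrite ?addr0.
- by apply/setIidPr => _ ->; apply: submodule0 sL.
Qed.

End SubmoduleLattice.

Theorem theorem3p13 (R : pzRingType) (M : lmodType R^c) :
  UC_module [set: M] -> extending_module [set: M] ->
  Rad_D11_module [set: M] <-> C_Rad_D11_module [set: M].
Proof.
move=> UC ext.
have sM : submodule [set: M] [set: M] by apply: submodule_intro.
split=> [D11 D dD | cD11]; first exact: Rad_D11_direct_summand D11 dD.
exact/cD11/direct_summand_refl.
Qed.
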